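(* Let $n\ge 2$, let $\mathcal{H}=\mathcal{H}_1\otimes\cdots\otimes\mathcal{H}_n$ be an analytic Hilbert module over $\mathbb{C}[z_1,\ldots,z_n]$ and let $\mathcal{S}=(\mathcal{Q}_1\otimes\cdots\otimes\mathcal{Q}_n)^\perp$ be a co-doubly commuting submodule of $\mathcal{H}$, where $\mathcal{Q}_i$ is a quotient module of $\mathcal{H}_i$, $i=1,\ldots,n$. Then for all $1\le i<j\le n$, $$[R_{z_i}^*,R_{z_j}]=P_{\mathcal{Q}_1}\otimes\cdots\otimes\underbrace{P_{\mathcal{Q}_i}M_z^*P_{\mathcal{Q}_i^\perp}}_{i\text{-th}}\otimes\cdots\otimes\underbrace{P_{\mathcal{Q}_j^\perp}M_zP_{\mathcal{Q}_j}}_{j\text{-th}}\otimes\cdots\otimes P_{\mathcal{Q}_n},$$ where $R_{z_l}=M_{z_l}|_{\mathcal{S}}\in\mathcal{B}(\mathcal{S})$ for $1\le l\le n$.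
   Context: Let $\mathbb{D}$ be the open unit disc in $\mathbb{C}$. A reproducing kernel Hilbert module over $\mathbb{C}[z]$ is a Hilbert space $\mathcal{H}$ of holomorphic functions on $\mathbb{D}$ with bounded point evaluations (hence with a reproducing kernel $K$, $f(w)=\langle f,K(\cdot,w)\rangle$), containing the constant function $1$, on which multiplication by the coordinate, $M_z f=zf$, is a bounded operator $\mathcal{H}\to\mathcal{H}$. A closed subspace $\mathcal{S}\subseteq\mathcal{H}$ is a submodule if $M_z\mathcal{S}\subseteq\mathcal{S}$; a closed subspace $\mathcal{Q}$ is a quotient module if $\mathcal{Q}^\perp$ is a submodule. $\mathcal{H}$ is a standard Hilbert module over $\mathbb{C}[z]$ if there do not exist two non-zero quotient modules of $\mathcal{H}$ orthogonal to each other. A standard Hilbert module over $\mathbb{C}[z_1,\ldots,z_n]$ is a Hilbert space tensor product $\mathcal{H}=\mathcal{H}_1\otimes\cdots\otimes\mathcal{H}_n$ of standard Hilbert modules $\mathcal{H}_i$ over $\mathbb{C}[z]$, with module multiplication operators $M_{z_i}=I_{\mathcal{H}_1}\otimes\cdots\otimes M_z\otimes\cdots\otimes I_{\mathcal{H}_n}$ ($M_z$ in the $i$-th place). It is an analytic Hilbert module if moreover, for each $i$, with $K_i$ the kernel of $\mathcal{H}_i$, $K_i^{-1}(z,w)=1/K_i(z,w)$ is a polynomial in $z$ and $\bar w$. A closed subspace $\mathcal{S}\subseteq\mathcal{H}$ is a submodule if $M_{z_i}\mathcal{S}\subseteq\mathcal{S}$ for all $i$; a closed subspace $\mathcal{Q}$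 is a quotient module if $\mathcal{Q}^\perp$ is a submodule. For a quotient module put $C_{z_i}=P_{\mathcal{Q}}M_{z_i}|_{\mathcal{Q}}$; $\mathcal{Q}$ is doubly commuting if $C_{z_i}C_{z_j}^*=C_{z_j}^*C_{z_i}$ for all $1\le i<j\le n$. A submodule $\mathcal{S}$ is co-doubly commuting if the quotient module $\mathcal{S}^\perp$ is doubly commuting. $P_{\mathcal{L}}$ denotes the orthogonal projection onto a closed subspace $\mathcal{L}$; $[R,T]=RT-TR$; $\mathcal{Q}_i^\perp=\mathcal{H}_i\ominus\mathcal{Q}_i$. In the formula, operators on $\mathcal{S}$ are identified with operators on $\mathcal{H}$ vanishing on $\mathcal{S}^\perp$ (equivalently, the right-hand side, an operator on $\mathcal{H}$ mapping into $\mathcal{S}$, is restricted to $\mathcal{S}$). All tensor factors in positions other than $i$ and $j$ are $P_{\mathcal{Q}_l}$. *)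

(* Defs.v *)
From HB Require Import structures.
From mathcomp Require Import all_boot all_order all_algebra.
From mathcomp Require Import all_classical all_reals all_analysis.
From mathcomp.real_closed Require Import complex.

Set Implicit Arguments.
Unset Strict Implicit.
Unset Printing Implicit Defensive.

Import Order.TTheory GRing.Theory Num.Theory.
Import numFieldNormedType.Exports.

Local Open Scope classical_set_scope.
Local Open Scope ring_scope.
Local Open Scope complex_scope.

(* The topology of a Hilbert space is the one of its (R[i]-valued) norm, which
   is tied to the inner product; `{dot V for conjC}` is linear in its first
   argument and conjugate-linear in the second one. *)
HB.mixin Record isHilbert (R : realType) V & CompleteNormedModule R[i] V := {
  hdot : {dot V for (@Num.conj R[i])} ;
  hdotxx : forall x : V, hdot x x = `|x| ^+ 2 }.

#[short(type="hilbertType")]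
HB.structure Definition Hilbert (R : realType) :=
  {V of isHilbert R V & CompleteNormedModule R[i] V}.

Notation "''[' x , y ]" := (hdot x y) : ring_scope.

Section HilbertSpace.
Context {R : realType}.
Implicit Types H : hilbertType R.

Definition bounded_op H (T : H -> H) : Prop :=
  linear T /\ exists c : R[i], forall x, `|T x| <= c * `|x|.

Definition closed_subspace H (L : set H) : Prop :=
  [/\ closed L, L 0 &
      forall (a : R[i]) x y, L x -> L y -> L (a *: x + y)].

Definition closed_span H (G : set H) : set H := smallest (@closed_subspace H) G.

Definition orthogonal_sets H (A B : set H) : Prop :=
  forall x y, A x -> B y -> '[x, y] = 0.

Definition orthocompl H (L : set H) : set H :=
  [set x | forall y, L y -> '[x, y] = 0].

(* P_L, for L a closed subspace: the unique p in L with x - p orthogonal to L *)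
Definition orthoproj H (L : set H) (x : H) : H :=
  xget 0 [set p | L p /\ orthocompl L (x - p)].

(* The adjoint in B(L) of an operator T of the closed subspace L: only the
   values of T on L matter. For x orthogonal to L, T u is orthogonal to x for
   all u in L, so that this is the adjoint extended by 0 off L. *)
Definition adjoint_on H (L : set H) (T : H -> H) (x : H) : H :=
  xget 0 [set y | L y /\ forall u, L u -> '[T u, x] = '[u, y]].

Definition adjoint H (T : H -> H) : H -> H := adjoint_on setT T.

(* The restriction of T to L, as an operator on H vanishing on the orthogonal
   complement of L *)
Definition restrict_op H (L : set H) (T : H -> H) : H -> H := T \o orthoproj L.

Definition commutator H (T U : H -> H) : H -> H :=
  fun x => T (U x) - U (T x).

End HilbertSpace.

Section OneVariable.
Context {R : realType}.

Definition unit_disc : set R[i] := [set z | `|z| < 1].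

(* A Hilbert space of functions on the disc is an abstract Hilbert space
   together with an injective linear evaluation; the values of `ev f` outside
   of the disc are irrelevant. *)
Record rk_module := RKModule {
  rk_space :> hilbertType R ;
  ev : rk_space -> R[i] -> R[i] ;
  ev_linear : forall (a : R[i]) f g z, unit_disc z ->
    ev (a *: f + g) z = a * ev f z + ev g z ;
  ev_inj : forall f g, (forall z, unit_disc z -> ev f z = ev g z) -> f = g ;
  ev_holomorphic : forall f z, unit_disc z ->
    derivable (ev f : R[i]^o -> R[i]^o) z 1 ;
  ev_bounded : forall w, unit_disc w ->
    exists c : R[i], forall f, `|ev f w| <= c * `|f| ;
  has_one : exists f, forall z, unit_disc z -> ev f z = 1 ;
  Mz : rk_space -> rk_space ;
  MzE : forall f z, unit_disc z -> ev (Mz f) z = z * ev f z ;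
  Mz_bounded : bounded_op Mz }.

Implicit Types H : rk_module.

Definition is_submodule H (L : set H) : Prop :=
  closed_subspace L /\ forall f, L f -> L (Mz f).

Definition is_quotient_module H (Q : set H) : Prop :=
  closed_subspace Q /\ is_submodule (orthocompl Q).

Definition standard_module H : Prop :=
  ~ exists Q1 Q2 : set H,
      [/\ is_quotient_module Q1, is_quotient_module Q2,
          Q1 <> [set 0], Q2 <> [set 0] & orthogonal_sets Q1 Q2].

Definition is_kernel H (K : R[i] -> R[i] -> R[i]) : Prop :=
  forall w, unit_disc w -> exists k : H,
    (forall f, ev f w = '[f, k]) /\ (forall z, unit_disc z -> ev k z = K z w).

Definition polynomial_inverse_kernel H : Prop :=
  exists2 K, is_kernel H K &
  exists p : {poly {poly R[i]}}, forall z w, unit_disc z -> unit_disc w ->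
    K z w != 0 /\ (K z w)^-1 = p.[z, Num.conj w].

End OneVariable.

Arguments rk_module R : clear implicits.

Section TensorProduct.
Context {R : realType} {n : nat}.

(* The Hilbert space tensor product, characterised up to a unique unitary
   isomorphism compatible with the elementary tensors x_1 (x) .. (x) x_n. *)
Record hilbert_tensor (H : 'I_n -> hilbertType R) := HilbertTensor {
  tensor_space :> hilbertType R ;
  tens : (forall i, H i) -> tensor_space ;
  tens_multilinear : forall (x : forall i, H i) i (a : R[i]) (u v : H i),
    tens (dfwith x i (a *: u + v)) =
    a *: tens (dfwith x i u) + tens (dfwith x i v) ;
  tens_dot : forall x y, '[tens x, tens y] = \prod_i '[x i, y i] ;
  tens_dense : closed_span (range tens) = setT }.

Section Operators.
Context {H : 'I_n -> hilbertType R} (HH : hilbert_tensor H).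

Definition tensor_subspace (Q : forall i, set (H i)) : set HH :=
  closed_span [set tens HH x | x in [set x | forall i, Q i (x i)]].

(* A_1 (x) .. (x) A_n, for bounded operators A_i: the unique bounded operator
   mapping each x_1 (x) .. (x) x_n to A_1 x_1 (x) .. (x) A_n x_n. *)
Definition tensor_op (A : forall i, H i -> H i) : HH -> HH :=
  xget (fun=> 0)
    [set T | bounded_op T /\
             forall x, T (tens HH x) = tens HH (fun i => A i (x i))].

End Operators.

(* The Hilbert module over C[z_1, .., z_n] is any tensor product of the H i; its
   being standard and analytic only depends on the factors. *)
Definition analytic_hilbert_module (H : 'I_n -> rk_module R) : Prop :=
  forall i, standard_module (H i) /\ polynomial_inverse_kernel (H i).

Section Modules.
Context {H : 'I_n -> rk_module R} (HH : hilbert_tensor H).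

Definition Mzi (i : 'I_n) : HH -> HH :=
  tensor_op (dfwith (fun k (x : H k) => x) i (@Mz R (H i))).

Definition is_submodule_n (S : set HH) : Prop :=
  closed_subspace S /\ forall i f, S f -> S (Mzi i f).

Definition is_quotient_module_n (Q : set HH) : Prop :=
  closed_subspace Q /\ is_submodule_n (orthocompl Q).

(* C_{z_i}, as an operator of the Hilbert space Q *)
Definition Czi (Q : set HH) (i : 'I_n) : HH -> HH := orthoproj Q \o Mzi i.

Definition doubly_commuting (Q : set HH) : Prop :=
  is_quotient_module_n Q /\
  forall i j : 'I_n, (i < j)%N -> forall x, Q x ->
    Czi Q i (adjoint_on Q (Czi Q j) x) = adjoint_on Q (Czi Q j) (Czi Q i x).

Definition co_doubly_commuting (S : set HH) : Prop :=
  is_submodule_n S /\ doubly_commuting (orthocompl S).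

(* R_{z_i}, for a submodule S *)
Definition Rzi (S : set HH) (i : 'I_n) : HH -> HH := restrict_op S (Mzi i).

End Modules.
End TensorProduct.

Arguments tensor_subspace {R n H} HH Q _.
Arguments tensor_op {R n H} HH A _.
Arguments Mzi {R n H} HH i _.

(* Main.v *)
Require Import Defs.
From mathcomp Require Import all_boot all_order all_algebra.
From mathcomp Require Import all_classical all_reals all_analysis.
From mathcomp Require Import ring.
From mathcomp.real_closed Require Import complex.

(** Write P for the orthogonal projection onto the tensor product of the Q l,
    and P' = 1 - P for the projection onto S. Since S is invariant under the
    multiplications, P' M_i^* P' = P' M_i^* and P' M_j P' = M_j P', and the
    adjoint of R_i is the compression P' M_i^* of M_i^*. As M_i and M_j act on
    different tensor factors, M_i^* commutes with M_j, so that
      [R_i^*, R_j] = P' M_j M_i^* P' - P' M_j P' M_i^* P' = P' M_j P M_i^* P'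
    ([commutator_restrict]). All five factors are explicit on elementary
    tensors, where P is the tensor product of the projections P_l onto the Q l
    ([orthoproj_tens]). There M_j P M_i^* is P_i M_z^* in position i,
    M_z P_j in position j and P_l elsewhere; replacing P' by 1 - P on the right
    only turns the factor in position i into P_i M_z^* (1 - P_i), and on the
    left the factor in position j into (1 - P_j) M_z P_j. A bounded
    operator is determined by its values on elementary tensors, which gives the
    formula.

    This computation rests on the Hilbert space facts that give a meaning to
    its terms: the projection theorem ([projection_exists]), the Riesz theorem
    and the existence of adjoints ([Riesz], [adjointP]), and the existence of
    the bounded operator 1 (x) .. (x) A (x) .. (x) 1 on a Hilbert tensor product
    ([tens_bounded_factor]). The last one is the main point: on finite sums of
    elementary tensors, the bound |T u| <= c |u| says that the entrywise
    product of the positive kernel c^2 <x_k, x_l> - <A x_k, A x_l> with Gram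
    kernels of the other factors is positive, an instance of the Schur product
    theorem ([psd_mul_gram]); the operator is then extended by density. *)

Set Implicit Arguments.
Unset Strict Implicit.
Unset Printing Implicit Defensive.

Import Order.TTheory GRing.Theory Num.Theory.
Import numFieldNormedType.Exports.

Local Open Scope classical_set_scope.
Local Open Scope ring_scope.

(** * Scalars: infima and reciprocals of integers in R[i] *)

Section Scalars.
Context {R : realType}.

Lemma complex_ge0P (z : R[i]) : 0 <= z -> exists2 r : R, 0 <= r & z = complex.Complex r 0.
Proof.
case: z => a b; rewrite lecE /= => /andP[/eqP b0 a0].
by exists a => //; congr complex.Complex.
Qed.

(** The order of R[i] is partial, but nonnegative elements are real, so the
    completeness of the reals applies to them. *)
Lemma complex_inf (A : set R[i]) : A !=set0 -> (forall a, A a -> 0 <= a) ->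
  exists d, (forall a, A a -> d <= a) /\
    forall e, 0 < e -> exists2 a, A a & a < d + e.
Proof.
move=> A0 Age0; pose B : set R := [set complex.Re a | a in A].
have Binf : has_inf B.
  split; first by case: A0 => a Aa; exists (complex.Re a), a.
  by exists 0 => _ [a /Age0 /complex_ge0P[r r0 ->] <-].
have BE a : A a -> a = complex.Complex (complex.Re a) 0.
  by move=> /Age0 /complex_ge0P[r _ ->].
exists (complex.Complex (inf B) 0); split=> [a Aa|e e0].
  rewrite (BE _ Aa) lecE /= eqxx /=; apply: (ge_inf Binf.2); by exists a.
have [r r0 eE] := complex_ge0P (ltW e0).
have {}r0 : 0 < r by move: e0; rewrite eE ltcE /= eqxx.
have [_ [a Aa <-] lt_a] := inf_adherent r0 Binf.
by exists a => //; rewrite eE (BE _ Aa) ltcE /= addr0 eqxx.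
Qed.

Lemma complex_archi (e : R[i]) : 0 < e -> exists n : nat, n.+1%:R^-1 < e.
Proof.
move=> e0; have [r r0 eE] := complex_ge0P (ltW e0).
have {}r0 : 0 < r by move: e0; rewrite eE ltcE /= eqxx.
have [n nr] : exists n : nat, r^-1 < n.+1%:R.
  exists (Num.bound r^-1); rewrite (lt_trans (archi_boundP _)) ?invr_ge0 ?ltW//.
  by rewrite ltr_nat.
exists n; rewrite -[e]invrK ltf_pV2 ?posrE ?invr_gt0 ?ltr0n//.
have -> : e^-1 = (r^-1)%:C%C by rewrite eE -[complex.Complex r 0]/(r%:C%C) fmorphV.
by rewrite -(rmorph_nat (real_complex R)) ltcR.
Qed.
End Scalars.

(** * Inner product and completeness *)

Section InnerProduct.
Context {R : realType}.
Implicit Types V : hilbertType R.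

Lemma hdotZl V a (x y : V) : '[a *: x, y] = a * '[x, y].
Proof. exact: linearZl_LR. Qed.

Lemma hdotZr V a (x y : V) : '[x, a *: y] = Num.conj a * '[x, y].
Proof. exact: linearZr_LR. Qed.

Lemma hdotC V (x y : V) : '[x, y] = Num.conj '[y, x].
Proof. by rewrite hermC /= expr0 mul1r. Qed.

Lemma hdot_eq0C V (x y : V) : '[x, y] = 0 -> '[y, x] = 0.
Proof. by rewrite [in X in _ -> X]hdotC => ->; rewrite rmorph0. Qed.

Lemma hdot_eq0 V (x : V) : '[x, x] = 0 -> x = 0.
Proof. by rewrite hdotxx => /eqP; rewrite sqrf_eq0 normr_eq0 => /eqP. Qed.

Lemma hdot_ge0 V (x : V) : 0 <= '[x, x].
Proof. by rewrite hdotxx exprn_ge0. Qed.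

Lemma hdot_inj V (x y : V) : (forall z, '[x, z] = '[y, z]) -> x = y.
Proof.
move=> xy; apply/eqP; rewrite -subr_eq0; apply/eqP/hdot_eq0.
by rewrite linearBl /= xy subrr.
Qed.

(** The component of x orthogonal to y, with a = 0 when y = 0. This identity
    gives the Cauchy-Schwarz inequality, by positivity, and the orthogonality
    of near-minimizers of the distance to a subspace. *)
Lemma hdot_residue V (x y : V) (a := '[x, y] / '[y, y]) :
  '[x - a *: y, x - a *: y] = '[x, x] - `|'[x, y]| ^+ 2 / '[y, y].
Proof.
have [->|y0] := eqVneq y 0.
  by rewrite scaler0 !subr0 linear0r normr0 expr0n /= mul0r subr0.
have yy : '[y, y] != 0 by apply: contra y0 => /eqP/hdot_eq0->.
rewrite linearBr /= linearZr_LR /=.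
have -> : '[x - a *: y, y] = 0.
  by rewrite linearBl /= linearZl_LR /= divfK// subrr.
rewrite mulr0 subr0 linearBl /= linearZl_LR /= [in '[y, x]]hdotC normCK /a.
by rewrite mulrAC.
Qed.

Lemma Cauchy_Schwarz V (x y : V) : `|'[x, y]| <= `|x| * `|y|.
Proof.
rewrite -(@ler_pXn2r _ 2) ?nnegrE ?mulr_ge0//.
have [->|y0] := eqVneq y 0; first by rewrite linear0r !normr0 mulr0.
have := hdot_ge0 (x - ('[x, y] / '[y, y]) *: y).
rewrite hdot_residue subr_ge0 !hdotxx ler_pdivrMr ?exprn_gt0 ?normr_gt0//.
by rewrite exprMn.
Qed.

Lemma closed_approxP V (L : set V) : closed L <->
  forall x, (forall e, 0 < e -> exists2 y, L y & `|x - y| < e) -> L x.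
Proof.
split=> [cL x xL|aL x xL].
  apply: cL => B /nbhs_ballP[e /= e0 eB]; have [y Ly xy] := xL _ e0.
  by exists y; split=> //; apply: eB; rewrite -ball_normE.
apply: aL => e e0; have [y [Ly]] := xL _ (nbhsx_ballx x e e0).
by rewrite -ball_normE /= => xy; exists y.
Qed.

Lemma complete_seq V (u : nat -> V) :
  (forall e, 0 < e -> exists N, forall m n,
     (N <= m)%N -> (N <= n)%N -> `|u m - u n| < e) ->
  exists p, forall e, 0 < e -> exists N, forall n, (N <= n)%N -> `|p - u n| < e.
Proof.
move=> uC; have /cauchy_cvgP/cvg_ex[p up] : cauchy (u @ \oo).
  apply: cauchy_exP => e e0; have [N uN] := uC _ e0.
  exists (u N); exists N => // n /= Nn; rewrite -ball_normE /=; exact: uN.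
exists p => e e0; have /cvgrPdist_lt/(_ _ e0)[N _ uN] := up.
by exists N => n Nn; apply: uN.
Qed.
End InnerProduct.

(** * Closed subspaces and the projection theorem *)

Section ClosedSubspaces.
Context {R : realType}.
Implicit Types V W : hilbertType R.

(** A bound c of an operator need not be a nonnegative number when the space
    is zero, hence the detour by |c| + 1. *)
Lemma positive_bound V W (f : V -> W) (c : R[i]) :
  (forall x, `|f x| <= c * `|x|) ->
  exists2 c', 0 < c' & forall x, `|f x| <= c' * `|x|.
Proof.
move=> fc; exists (`|c| + 1) => [|x]; first by rewrite ltr_wpDl.
rewrite mulrDl mul1r (le_trans (fc x))//.
by rewrite -[leLHS]ger0_norm ?(le_trans _ (fc x))// normrM normr_id lerDl.
Qed.

Lemma norm_hdot_ub V (x : V) (e : R[i]) : 0 <= e ->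
  (forall y, `|'[x, y]| <= e * `|y|) -> `|x| <= e.
Proof.
move=> e0 /(_ x); rewrite hdotxx normrX normr_id expr2.
have [->|x0] := eqVneq x 0; first by rewrite normr0.
by rewrite ler_pM2r// normr_gt0.
Qed.

Lemma closed_kernel V (f : V -> R[i]) (c : R[i]) :
  (forall x y, f (x - y) = f x - f y) -> (forall x, `|f x| <= c * `|x|) ->
  closed [set x | f x = 0].
Proof.
move=> fB fc; apply/closed_approxP => x xf /=; apply/eqP/negP => /negP fx0.
have c0 : 0 < `|c| + 1 by rewrite ltr_wpDl.
have [|y /= fy0] := xf (`|f x| / (`|c| + 1)); first by rewrite divr_gt0 ?normr_gt0.
rewrite ltr_pdivlMr// lt_leAnge => /andP[_] /negP; apply.
have -> : f x = f (x - y) by rewrite fB fy0 subr0.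
rewrite mulrC mulrDl mul1r (le_trans (fc _))//.
by rewrite -[leLHS]ger0_norm ?(le_trans _ (fc _))// normrM normr_id lerDl.
Qed.

Lemma subspaceD V (L : set V) x y : closed_subspace L -> L x -> L y -> L (x + y).
Proof. by case=> _ _ LL Lx Ly; rewrite -[x]scale1r; apply: LL. Qed.

Lemma subspaceZ V (L : set V) a x : closed_subspace L -> L x -> L (a *: x).
Proof. by case=> _ L0 LL Lx; rewrite -[_ *: _]addr0; apply: LL. Qed.

Lemma subspaceB V (L : set V) x y : closed_subspace L -> L x -> L y -> L (x - y).
Proof.
move=> cL Lx Ly; apply: subspaceD => //.
by rewrite -scaleN1r; apply: subspaceZ.
Qed.

Lemma closed_subspace_closed_span V (G : set V) : closed_subspace (closed_span G).
Proof.
split.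
- apply/closed_approxP => x xL L [Lc GL]; have [/closed_approxP cL _ _] := Lc.
  by apply: cL => e /xL[y yG xy]; exists y => //; apply: yG.
- by move=> L [[]].
- by move=> a x y Lx Ly L LG; have [[_ _ LL] _] := LG; apply: LL; [apply: Lx|apply: Ly].
Qed.

Lemma sub_closed_span V (G : set V) : G `<=` closed_span G.
Proof. by move=> x Gx L [_]; apply. Qed.

Lemma closed_subspace_orthocompl V (L : set V) : closed_subspace (orthocompl L).
Proof.
split=> [|y _|a x y xL yL z Lz]; last 2 first.
- exact: linear0l.
- by rewrite linearPl /= xL// yL// mulr0 addr0.
apply/closed_approxP => x xL y Ly.
have /closed_approxP : closed [set z | '[z, y] = 0].
  apply: (@closed_kernel _ _ `|y|) => [u v|u]; first by rewrite linearBl.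
  by rewrite mulrC; exact: Cauchy_Schwarz.
by apply=> e /xL[z Lz xz]; exists z => //=; exact: Lz.
Qed.

Lemma orthocompl_closed_span V (G : set V) : orthocompl (closed_span G) = orthocompl G.
Proof.
apply/seteqP; split=> x xG y Gy; first by apply: xG; exact: sub_closed_span.
apply/hdot_eq0C; apply: (Gy (orthocompl [set x])) => //; split=> [|{}y {}Gy _ ->].
  exact: closed_subspace_orthocompl.
by apply/hdot_eq0C/xG.
Qed.

(** Totality as an injectivity principle: identities between vectors of a
    tensor product only have to be tested on elementary tensors. *)
Lemma eq_hdot_total V (G : set V) : closed_span G = setT -> forall x y,
  (forall z, G z -> '[x, z] = '[y, z]) -> x = y.
Proof.
move=> GT x y xy; apply/eqP; rewrite -subr_eq0; apply/eqP/hdot_eq0.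
have : orthocompl G (x - y) by move=> z Gz; rewrite linearBl /= xy// subrr.
by rewrite -orthocompl_closed_span GT; apply.
Qed.

(** If y minimizes the squared distance from x to L up to e^2, then moving y along z by
    the optimal multiple gains |<x - y, z>|^2 / |z|^2, which cannot exceed e^2.
    Thus approximate minimizers are approximately orthogonal. *)
Lemma projection_approx V (L : set V) (x : V) (d e : R[i]) y : closed_subspace L ->
  (forall z, L z -> d <= `|x - z| ^+ 2) -> 0 <= e -> L y -> `|x - y| ^+ 2 <= d + e ^+ 2 ->
  forall z, L z -> `|'[x - y, z]| <= e * `|z|.
Proof.
move=> cL dL e0 Ly xy z Lz; have [->|z0] := eqVneq z 0.
  by rewrite linear0r !normr0 mulr0.
rewrite -(@ler_pXn2r _ 2) ?nnegrE ?mulr_ge0// exprMn.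
have := dL _ (subspaceD cL Ly (subspaceZ ('[x - y, z] / '[z, z]) cL Lz)).
rewrite opprD addrA -hdotxx hdot_residue !hdotxx lerBrDr => h.
have := le_trans h xy; rewrite lerD2l ler_pdivrMr// exprn_gt0// normr_gt0//.
Qed.

Lemma eventually_invn_lt (e : R[i]) : 0 < e ->
  exists N, forall n, (N <= n)%N -> n.+1%:R^-1 < e.
Proof.
move=> /complex_archi[N Ne]; exists N => n Nn; apply: le_lt_trans Ne.
by rewrite lef_pV2 ?posrE ?ltr0n// ler_nat.
Qed.

Lemma complete_seq_invn V (u : nat -> V) (c : R[i]) : 0 < c ->
  (forall m n, `|u m - u n| <= c * (m.+1%:R^-1 + n.+1%:R^-1)) ->
  exists p, forall e, 0 < e -> exists N, forall n, (N <= n)%N -> `|p - u n| < e.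
Proof.
move=> c0 uc; apply: complete_seq => e e0.
have [N NP] := @eventually_invn_lt (e / c / 2) ltac:(by rewrite !divr_gt0).
exists N => m n Nm Nn; apply: (le_lt_trans (uc m n)).
by rewrite mulrC -ltr_pdivlMr// [ltRHS]splitr ltrD// NP.
Qed.

(** The estimate of [projection_approx] for a minimizing sequence u also shows
    that u is Cauchy: with w = u m - u n, which lies in L,
    |w|^2 = <x - u n, w> - <x - u m, w> <= (1/(n+1) + 1/(m+1)) |w|. *)
Lemma projection_exists V (L : set V) (x : V) : closed_subspace L ->
  exists p, L p /\ orthocompl L (x - p).
Proof.
move=> cL; have [cl L0 LL] := cL.
have [||d [dL dinf]] := @complex_inf R [set `|x - y| ^+ 2 | y in L].
- by exists (`|x - 0| ^+ 2), 0.
- by move=> _ [y _ <-]; rewrite exprn_ge0.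
have /choice[u uP] (n : nat) : exists y, L y /\
    forall z, L z -> `|'[x - y, z]| <= n.+1%:R^-1 * `|z|.
  have [|_ [y Ly <-] xy] := dinf (n.+1%:R^-1 ^+ 2).
    by rewrite exprn_gt0// invr_gt0 ltr0n.
  exists y; split=> //; apply: (@projection_approx _ _ _ d) => //.
  - by move=> z Lz; apply: dL; exists z.
  - exact: ltW.
have [||p pu] := @complete_seq_invn _ u 1 => // [m n|].
  have [Lm um] := uP m; have [Ln un] := uP n.
  rewrite mul1r; set w := u m - u n.
  have Lw : L w by exact: subspaceB.
  have [->|w0] := eqVneq w 0; first by rewrite normr0 addr_ge0// invr_ge0 ler0n.
  rewrite -(@ler_pM2r _ `|w|) ?normr_gt0// -expr2.
  rewrite -(ger0_norm (exprn_ge0 2 (normr_ge0 w))) -hdotxx.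
  have {1}-> : w = (x - u n) - (x - u m) by rewrite opprB [RHS]addrC addrA subrK.
  rewrite linearBl /= (le_trans (ler_normB _ _))// mulrDl addrC.
  by rewrite lerD//; [exact: um|exact: un].
exists p; split.
  move/closed_approxP: cl; apply=> e /pu[N /(_ N (leqnn N)) pN].
  by exists (u N) => //; case: (uP N).
move=> y Ly; have [->|y0] := eqVneq y 0; first by rewrite linear0r.
apply/eqP/negP => /negP xy0.
have yp : 0 < `|y| by rewrite normr_gt0.
pose e := `|'[x - p, y]| / `|y| / 2.
have e0 : 0 < e by rewrite !divr_gt0// normr_gt0.
have [N1 N1P] := pu _ e0; have [N2 N2P] := eventually_invn_lt e0.
have [_ uy] := uP (maxn N1 N2).
have : `|'[x - p, y]| < (e + e) * `|y|.
  rewrite -(subrK (u (maxn N1 N2)) x) -addrA linearDl /= (le_lt_trans (ler_normD _ _))//.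
  rewrite mulrDl ltr_leD//.
    by rewrite (le_lt_trans (uy _ Ly))// ltr_pM2r// N2P// leq_maxr.
  rewrite (le_trans (Cauchy_Schwarz _ _))// ler_pM2r// distrC ltW// N1P// leq_maxl//.
by rewrite -splitr divfK ?ltxx// normr_eq0.
Qed.
End ClosedSubspaces.

(** * Orthogonal projections, bounded operators and adjoints *)

Section BoundedOperators.
Context {R : realType}.
Implicit Types V : hilbertType R.

Section Orthoproj.
Context {V : hilbertType R} (L : set V).
Context (cL : closed_subspace L).

Lemma orthoprojP x : L (orthoproj L x) /\ orthocompl L (x - orthoproj L x).
Proof.
rewrite /orthoproj; have [p pP] := projection_exists x cL.
by have := @xgetPex _ 0 [set p | L p /\ orthocompl L (x - p)] (ex_intro _ p pP).
Qed.

Lemma orthoproj_in x : L (orthoproj L x). Proof. by case: (orthoprojP x). Qed.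

Lemma orthoproj_eq x p : L p -> orthocompl L (x - p) -> orthoproj L x = p.
Proof.
move=> Lp xp; have [Lq xq] := orthoprojP x.
set q := orthoproj L x in Lq xq *; apply/eqP; rewrite -subr_eq0.
apply/eqP/hdot_eq0; have Lqp : L (q - p) by exact: subspaceB.
have {1}-> : q - p = (x - p) - (x - q) by rewrite opprB [RHS]addrC addrA subrK.
by rewrite linearBl /= xp// xq// subrr.
Qed.

Lemma orthoproj_id x : L x -> orthoproj L x = x.
Proof.
move=> Lx; apply: orthoproj_eq => //; rewrite subrr => y _; exact: linear0l.
Qed.

Lemma orthoproj_idem x : orthoproj L (orthoproj L x) = orthoproj L x.
Proof. by apply/orthoproj_id/orthoproj_in. Qed.

Lemma orthoproj0 x : orthocompl L x -> orthoproj L x = 0.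
Proof. by move=> Lx; apply: orthoproj_eq; rewrite ?subr0//; case: cL. Qed.

Lemma orthoproj_sym x y : '[orthoproj L x, y] = '[x, orthoproj L y].
Proof.
have [Lx xP] := orthoprojP x; have [Ly yP] := orthoprojP y.
rewrite -[in LHS](subrK (orthoproj L y) y) -[in RHS](subrK (orthoproj L x) x).
rewrite linearDr linearDl /=; congr (_ + _).
by rewrite xP// (hdot_eq0C (yP _ Lx)).
Qed.

Lemma orthoproj_compl x : orthoproj (orthocompl L) x = x - orthoproj L x.
Proof.
have [Lx xP] := orthoprojP x.
have cL' : closed_subspace (orthocompl L) by exact: closed_subspace_orthocompl.
set y := orthoproj L x in Lx xP *.
rewrite /orthoproj; apply: xget_unique => [|z [Lz xz]] /=.
  by split=> // z Lz; rewrite opprB addrC subrK; apply: hdot_eq0C; exact: Lz.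
apply/eqP; rewrite -subr_eq0; apply/eqP/hdot_eq0.
have Lw : orthocompl L (z - (x - y)) := subspaceB cL' Lz xP.
have {1}-> : z - (x - y) = y - (x - z) by rewrite !opprB addrCA.
by rewrite linearBl /= xz// subr0; apply/hdot_eq0C/Lw.
Qed.

Lemma orthoproj_bounded : bounded_op (orthoproj L).
Proof.
split=> [a x y|].
  by apply: hdot_inj => z; rewrite linearPl /= !orthoproj_sym linearPl.
exists 1 => x; rewrite mul1r; apply: norm_hdot_ub => // y.
rewrite -[in '[_, _]](subrK (orthoproj L y) y) linearDr /=.
have [Ly yP] := orthoprojP y; have [Lx _] := orthoprojP x.
rewrite (hdot_eq0C (yP _ Lx)) add0r orthoproj_sym orthoproj_idem.
rewrite (le_trans (Cauchy_Schwarz _ _))// ler_wpM2l//.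
rewrite -(@ler_pXn2r _ 2) ?nnegrE// -!hdotxx.
set p := orthoproj L y in Ly yP *.
have -> : '[y, y] = '[y - p, y - p] + '[p, p].
  by rewrite -hnormDd ?subrK//; exact: yP.
by rewrite lerDr hdot_ge0.
Qed.

End Orthoproj.

Lemma bounded_op_linearB V (T : V -> V) x y : bounded_op T -> T (x - y) = T x - T y.
Proof. by move=> [Tl _]; rewrite -scaleN1r addrC Tl scaleN1r addrC. Qed.

Lemma bounded_op_comp V (T U : V -> V) :
  bounded_op T -> bounded_op U -> bounded_op (T \o U).
Proof.
move=> [Tl [c /positive_bound[{}c c0 Tc]]] [Ul [d Ud]].
split=> [a x y|]; first by rewrite /= Ul Tl.
by exists (c * d) => x; rewrite -mulrA (le_trans (Tc _))// ler_pM2l.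
Qed.

Lemma bounded_op_sub V (T U : V -> V) : bounded_op T -> bounded_op U ->
  bounded_op (fun x => T x - U x).
Proof.
move=> [Tl [c Tc]] [Ul [d Ud]]; split=> [a x y|].
  by rewrite Tl Ul opprD addrACA scalerBr.
by exists (c + d) => x; rewrite mulrDl (le_trans (ler_normB _ _))// lerD.
Qed.

Lemma eq_bounded_op_total V (G : set V) (T U : V -> V) : closed_span G = setT ->
  bounded_op T -> bounded_op U -> {in G, T =1 U} -> T = U.
Proof.
move=> GT bT bU TU; apply/funext => x.
pose D y := T y - U y; have bD : bounded_op D by exact: bounded_op_sub.
have DB y z : D (y - z) = D y - D z := bounded_op_linearB y z bD.
suff : [set y | forall z, '[D y, z] = 0] x.
  by move=> /= h; apply: hdot_inj => y; apply/eqP; rewrite -subr_eq0 -linearBl /= h.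
have : closed_span G x by rewrite GT.
have [Dl [c Dc]] := bD.
apply; split; last first.
  by move=> y Gy z; rewrite /D TU ?subrr ?linear0l// inE.
split=> [|z|a y z hy hz w]; last 2 first.
- by rewrite -(subrr 0) DB subrr linear0l.
- by rewrite Dl linearPl /= hy hz mulr0 addr0.
rewrite (_ : mkset _ = \bigcap_y [set x | '[D x, y] = 0]); last first.
  by apply/seteqP; split=> y /= h z; [move=> _; exact: h|exact: (h z I)].
apply: closed_bigI => y _; apply: (@closed_kernel _ _ _ (c * `|y|)) => [u v|u].
  by rewrite DB linearBl.
by rewrite (le_trans (Cauchy_Schwarz _ _))// mulrAC ler_wpM2r.
Qed.

(** A vector z orthogonal to the kernel of f represents f up to a scalar, since
    x - (f x / f z) z always lies in the kernel. *)
Lemma Riesz V (f : V -> R[i]) (c : R[i]) :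
  (forall (a : R[i]) x y, f (a *: x + y) = a * f x + f y) ->
  (forall x, `|f x| <= c * `|x|) -> exists y, forall x, f x = '[x, y].
Proof.
move=> fl fc.
have fB x y : f (x - y) = f x - f y.
  by rewrite -scaleN1r addrC fl mulN1r addrC.
have f0 : f 0 = 0 by rewrite -(subrr 0) fB subrr.
have cK : closed_subspace [set x | f x = 0].
  split=> [|//|a x y /= fx fy]; first exact: closed_kernel fc.
  by rewrite fl fx fy mulr0 addr0.
have [[x0 /eqP fx0]|fz] := pselect (exists x, f x <> 0); last first.
  by exists 0 => x; rewrite linear0r; apply: contrapT => fx; apply: fz; exists x.
have [fp pK] := orthoprojP cK x0; set z := x0 - _ in pK.
have fz : f z = f x0 by rewrite fB fp subr0.
have z0 : '[z, z] != 0.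
  by apply: contra fx0 => /eqP/hdot_eq0 zz; rewrite -fz zz f0.
exists (Num.conj (f z / '[z, z]) *: z) => x; rewrite linearZr_LR /= conjCK.
have fzN0 : f z != 0 by rewrite fz.
have /pK/hdot_eq0C : f (x - (f x / f z) *: z) = 0.
  by rewrite fB -[_ *: z]addr0 fl f0 addr0 divfK// subrr.
rewrite linearBl /= linearZl_LR /= => /eqP; rewrite subr_eq0 => /eqP ->.
by rewrite mulrACA mulVf// mulr1 mulrC divfK.
Qed.

Lemma adjoint_onE V (L : set V) (T : V -> V) x y : closed_subspace L ->
  L y -> (forall u, L u -> '[T u, x] = '[u, y]) -> adjoint_on L T x = y.
Proof.
move=> cL Ly Ty; apply: xget_unique => [//|z [Lz Tz]].
apply/eqP; rewrite -subr_eq0; apply/eqP/hdot_eq0; rewrite linearBr /=.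
have Lzy : L (z - y) by exact: subspaceB.
by rewrite -Ty// -Tz// subrr.
Qed.

Lemma adjointP V (T : V -> V) : bounded_op T ->
  forall x y, '[T x, y] = '[x, adjoint T y].
Proof.
move=> [Tl [c Tc]] x y; have [|u|z zP] := @Riesz _ (fun x => '[T x, y]) (c * `|y|).
- by move=> a u v; rewrite Tl linearPl.
- by rewrite (le_trans (Cauchy_Schwarz _ _))// mulrAC ler_wpM2r.
rewrite /adjoint (@adjoint_onE _ _ _ _ z)//.
Qed.

Lemma adjointPl V (T : V -> V) : bounded_op T ->
  forall x y, '[adjoint T x, y] = '[x, T y].
Proof. by move=> bT x y; rewrite [LHS]hdotC -adjointP// -hdotC. Qed.

Lemma adjoint_bounded V (T : V -> V) : bounded_op T -> bounded_op (adjoint T).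
Proof.
move=> bT; have TP := adjointPl bT.
split=> [a x y|]; first by apply: hdot_inj => z; rewrite linearPl /= !TP linearPl.
have [Tl [c /positive_bound[{}c c0 Tc]]] := bT.
exists c => x; apply: norm_hdot_ub => [|y]; first by rewrite mulr_ge0// ltW.
rewrite TP (le_trans (Cauchy_Schwarz _ _))// mulrAC [leRHS]mulrC ler_wpM2l//.
Qed.

End BoundedOperators.

(** * Products of positive semidefinite kernels *)

Section SchurProduct.
Context {R : realType}.
Local Notation C := R[i].

Definition psd (I : finType) (P : I -> I -> C) : Prop :=
  forall c : I -> C, 0 <= \sum_k \sum_l c k * Num.conj (c l) * P k l.

Lemma hdot_sum (V : hilbertType R) (I J : finType) (c : I -> C) (x : I -> V)
  (d : J -> C) (y : J -> V) :
  '[\sum_k c k *: x k, \sum_l d l *: y l] =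
    \sum_k \sum_l c k * Num.conj (d l) * '[x k, y l].
Proof.
rewrite linear_sumlz; apply: eq_bigr => k _ /=.
rewrite linear_sumr; apply: eq_bigr => l _ /=.
by rewrite linearZl_LR linearZr_LR /= mulrA.
Qed.

(** A case of the Schur product theorem, by Gaussian elimination on the vectors
    x k. Subtracting from every x k its component along x k0 leaves vectors
    y k with y k0 = 0 and splits the Gram kernel as
    <x k, x l> = <y k, y l> + a k * conj (a l) * <x k0, x k0>. The second
    term multiplied by P is positive because P is, after scaling the test
    vector c by a; the first term has fewer nonzero vectors. *)
Lemma psd_mul_gram (V : hilbertType R) (I : finType) (P : I -> I -> C) (x : I -> V) :
  psd P -> psd (fun k l => P k l * '[x k, x l]).
Proof.
move=> P0; have : forall k, k \notin enum I -> x k = 0 by move=> k; rewrite mem_enum.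
elim: (enum I) x => [|k0 s IHs] x xs c.
  rewrite big1// => k _; rewrite big1// => l _.
  by rewrite xs// linear0l !mulr0.
pose a k := '[x k, x k0] / '[x k0, x k0]; pose y k := x k - a k *: x k0.
have aP k : x k0 != 0 -> a k * '[x k0, x k0] = '[x k, x k0].
  by move=> xk0; rewrite divfK//; apply: contra xk0 => /eqP/hdot_eq0->.
have yo k : '[y k, x k0] = 0.
  have [->|xk0] := eqVneq (x k0) 0; first exact: linear0r.
  by rewrite linearBl /= linearZl_LR /= aP// subrr.
have xE k l : '[x k, x l] = '[y k, y l] + a k * Num.conj (a l) * '[x k0, x k0].
  have yE m : x m = y m + a m *: x k0 by rewrite subrK.
  have yo' : '[x k0, y l] = 0 by exact/hdot_eq0C/yo.
  rewrite {1}(yE k) {1}(yE l); move: (yo k) yo'.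
  generalize (y k) (y l) (a k) (a l) => u v p q uo vo.
  by rewrite linearDl !linearDr /= !hdotZl !hdotZr uo vo !mulr0 addr0 add0r mulrA.
have ys k : k \notin s -> y k = 0.
  have [->|kk0] := eqVneq k k0 => ks.
    have [xk0|xk0] := eqVneq (x k0) 0; first by rewrite /y xk0 scaler0 subr0.
    rewrite /y /a divff ?scale1r ?subrr//.
    by apply: contra xk0 => /eqP/hdot_eq0->.
  by rewrite /y /a xs ?inE ?negb_or ?kk0// linear0l mul0r scale0r subr0.
have := addr_ge0 (IHs y ys c) (mulr_ge0 (P0 (fun k => c k * a k)) (hdot_ge0 (x k0))).
congr (0 <= _); rewrite mulr_suml -big_split; apply: eq_bigr => k _ /=.
rewrite mulr_suml -big_split; apply: eq_bigr => l _ /=.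
rewrite [in RHS]xE !mulrDr rmorphM /=; congr (_ + _); ring.
Qed.

Lemma psd_mul_prod_gram (I : finType) (J : eqType) (V : J -> hilbertType R) (s : seq J)
  (P : I -> I -> C) (x : I -> forall j, V j) :
  psd P -> psd (fun k l => P k l * \prod_(j <- s) '[x k j, x l j]).
Proof.
move=> P0; elim: s => [|j s IHs] c.
  by under eq_bigr do under eq_bigr do rewrite big_nil mulr1; exact: P0.
have := psd_mul_gram (fun k => x k j) IHs c; congr (0 <= _).
by apply: eq_bigr => k _; apply: eq_bigr => l _; rewrite big_cons; ring.
Qed.

(** Evaluated at u = \sum_k c k *: x k, this says that |T u| <= b |u|. *)
Lemma psd_bounded_gram (V : hilbertType R) (I : finType) (T : V -> V) (b : C)
    (x : I -> V) :
  linear T -> 0 <= b -> (forall x, `|T x| <= b * `|x|) ->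
  psd (fun k l => b ^+ 2 * '[x k, x l] - '[T (x k), T (x l)]).
Proof.
move=> Tl b0 Tb c; pose u := \sum_k c k *: x k.
have Tu : T u = \sum_k c k *: T (x k).
  have T0 : T 0 = 0 by have := Tl (-1) 0 0; rewrite scaler0 addr0 scaleN1r addNr.
  by rewrite /u; elim/big_rec2: _ => [//|k v w _ <-]; rewrite Tl.
have : 0 <= b ^+ 2 * '[u, u] - '[T u, T u].
  by rewrite subr_ge0 !hdotxx -exprMn ler_pXn2r ?nnegrE ?mulr_ge0.
rewrite Tu !hdot_sum mulr_sumr -sumrB; congr (0 <= _).
apply: eq_bigr => k _; rewrite mulr_sumr -sumrB; apply: eq_bigr => l _.
by rewrite mulrBr mulrCA.
Qed.

End SchurProduct.

(** * Extension of densely defined bounded operators *)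

Section Extension.
Context {R : realType}.
Local Notation C := R[i].

(** The closure in V x V of a binary relation, seen as the graph of a partial
    operator. *)
Definition rel_closure (V : hilbertType R) (G : V -> V -> Prop) (u v : V) : Prop :=
  forall e : C, 0 < e ->
    exists u' v', [/\ G u' v', `|u - u'| < e & `|v - v'| < e].

Lemma rel_closure_linear (V : hilbertType R) (G : V -> V -> Prop) :
  (forall a u v u' v', G u v -> G u' v' -> G (a *: u + u') (a *: v + v')) ->
  forall a u v u' v', rel_closure G u v -> rel_closure G u' v' ->
    rel_closure G (a *: u + u') (a *: v + v').
Proof.
move=> Gl a u v u' v' uv uv' e e0.
have a0 : 0 < `|a| + 1 by rewrite ltr_wpDl.
have d0 : 0 < e / (`|a| + 1) / 2 by rewrite !divr_gt0.
have [u1 [v1 [G1 uu1 vv1]]] := uv _ d0.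
have [u2 [v2 [G2 uu2 vv2]]] := uv' _ d0.
have close (x x' y y' : V) : `|x - x'| < e / (`|a| + 1) / 2 ->
    `|y - y'| < e / (`|a| + 1) / 2 -> `|a *: x + y - (a *: x' + y')| < e.
  move=> xx yy; rewrite opprD addrACA -scalerBr (le_lt_trans (ler_normD _ _))// normrZ.
  have : e = (`|a| + 1) * (e / (`|a| + 1) / 2) + (`|a| + 1) * (e / (`|a| + 1) / 2).
    by rewrite -mulrDr -splitr mulrC divfK// gt_eqF.
  move=> ->; rewrite ler_ltD//.
    by rewrite ler_pM// ?ltW// ltrDl.
  by rewrite (lt_le_trans yy)// ler_peMl ?(ltW d0)// lerDr.
by exists (a *: u1 + u2), (a *: v1 + v2); split; [exact: Gl| exact: close| exact: close].
Qed.

(** Extension by continuity, stated for a relation so that an operator given on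
    linear combinations of generators need not be shown well defined first:
    the bound forces the relation, and its closure, to be single-valued. *)
Lemma bounded_relation_ext (V : hilbertType R) (G : V -> V -> Prop) (b : C) : 0 <= b ->
  (forall a u v u' v', G u v -> G u' v' -> G (a *: u + u') (a *: v + v')) ->
  (forall u v, G u v -> `|v| <= b * `|u|) ->
  (forall u e, 0 < e -> exists u' v', G u' v' /\ `|u - u'| < e) ->
  exists2 T : V -> V, bounded_op T & forall u v, G u v -> T u = v.
Proof.
move=> b0 Gl Gb Gd.
have GB u v u' v' : G u v -> G u' v' -> G (u - u') (v - v').
  move=> uv uv'; have := Gl (-1) u' v' u v uv' uv.
  by rewrite !scaleN1r ![- _ + _]addrC.
pose GG := rel_closure G.
have GGl := rel_closure_linear Gl.
have GGb u v : GG u v -> `|v| <= b * `|u|.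
  move=> uv; apply/ler_addgt0Pr => e e0.
  have b1 : 0 < b + 1 by rewrite ltr_wpDl.
  have d0 : 0 < e / (b + 1) by rewrite divr_gt0.
  have [u' [v' [uv' uu vv]]] := uv _ d0.
  rewrite -[v](subrK v') (le_trans (ler_normD _ _))//.
  have : `|v'| <= b * (`|u| + e / (b + 1)).
    rewrite (le_trans (Gb _ _ uv'))// ler_wpM2l// -lerBlDl.
    by rewrite (le_trans (lerB_dist _ _))// distrC ltW.
  move=> h; rewrite (le_trans (lerD (ltW vv) h))// mulrDr addrCA lerD2l.
  by rewrite -{1}[e / _]mul1r -mulrDl addrC mulrC divfK// gt_eqF.
have GGe u : exists v, GG u v.
  have /choice[w wP] (k : nat) : exists p : V * V, G p.1 p.2 /\ `|u - p.1| < k.+1%:R^-1.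
    have [|u' [v' uv']] := Gd u (k.+1%:R^-1); first by rewrite invr_gt0 ltr0n.
    by exists (u', v').
  have [||v vP] := @complete_seq_invn _ _ (fun k => (w k).2) (b + 1).
  - by rewrite ltr_wpDl.
  - move=> k l; have [Gk uk] := wP k; have [Gl' ul] := wP l.
    rewrite (le_trans (Gb _ _ (GB _ _ _ _ Gk Gl')))//.
    rewrite ler_pM// ?lerDl//.
    have -> : (w k).1 - (w l).1 = (u - (w l).1) - (u - (w k).1).
      by rewrite opprB [RHS]addrC addrA subrK.
    by rewrite (le_trans (ler_normB _ _))// addrC lerD// ltW.
  exists v => e e0; have [N1 N1P] := vP _ e0; have [N2 N2P] := eventually_invn_lt e0.
  pose N := maxn N1 N2; have [GN uN] := wP N.
  exists (w N).1, (w N).2; split=> //; first by rewrite (lt_trans uN)// N2P// leq_maxr.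
  by apply: N1P; rewrite leq_maxl.
have GGu u v v' : GG u v -> GG u v' -> v = v'.
  move=> uv uv'; apply/eqP; rewrite -subr_eq0 -normr_le0.
  have := GGb _ _ (GGl (-1) _ _ _ _ uv' uv).
  by rewrite !scaleN1r addNr normr0 mulr0 addrC.
have /choice[T TP] := GGe; exists T.
  split=> [a x y|]; last by exists b => x; exact: GGb.
  exact: (GGu _ _ _ (TP _) (GGl a _ _ _ _ (TP x) (TP y))).
move=> u v uv; apply: (GGu _ _ _ (TP u)) => e e0.
by exists u, v; rewrite !subrr normr0.
Qed.

(** The points which E approximates form a closed subspace containing G. *)
Lemma closed_span_approx (V : hilbertType R) (G E : set V) : closed_span G = setT ->
  E 0 -> (forall (a : C) x y, E x -> E y -> E (a *: x + y)) -> G `<=` E ->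
  forall x e, 0 < e -> exists2 y, E y & `|x - y| < e.
Proof.
move=> GT E0 El GE x.
have xG : closed_span G x by rewrite GT.
apply: (xG [set x | forall e, 0 < e -> exists2 y, E y & `|x - y| < e]).
split; last by move=> y /GE Ey e e0; exists y; rewrite ?subrr ?normr0.
split.
- apply/closed_approxP => y yE e e0.
  have e2 : 0 < e / 2 by rewrite divr_gt0.
  have [z zE yz] := yE _ e2; have [w Ew zw] := zE _ e2.
  exists w => //; rewrite [e]splitr -(subrK z y) -addrA.
  by rewrite (le_lt_trans (ler_normD _ _))// ltrD.
- by move=> e e0; exists 0; rewrite ?subrr ?normr0.
- move=> a y z yE zE.
  (* Linearity comes from the closure of a relation with a free second
     component. *)
  pose G' (u _ : V) := E u.
  have GE' (u : V) : (forall e, 0 < e -> exists2 w, E w & `|u - w| < e) ->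
      rel_closure G' u 0.
    move=> uE e e0; have [w Ew uw] := uE e e0.
    by exists w, 0; split; rewrite // subrr normr0.
  have El' (c : C) (u v u' v' : V) :
      G' u v -> G' u' v' -> G' (c *: u + u') (c *: v + v') by exact: El.
  move=> e /(rel_closure_linear El' a (GE' _ yE) (GE' _ zE))[w [w' [Ew yzw _]]].
  by exists w.
Qed.
End Extension.

(** * Operators on a Hilbert tensor product *)

Section TensorOperators.
Context {R : realType} {n : nat} {H : 'I_n -> hilbertType R} (HH : hilbert_tensor H).
Local Notation C := R[i].
Implicit Types (x y z : forall l, H l) (i j : 'I_n).

(** Multilinearity for families which differ in one factor only; z carries the
    difference in that factor. *)
Lemma tensB_factor i x y z :
  (forall l, l != i -> x l = z l) -> (forall l, l != i -> y l = z l) ->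
  z i = x i - y i -> tens HH x - tens HH y = tens HH z.
Proof.
have fE (u v : forall l, H l) : (forall l, l != i -> u l = v l) -> u = dfwith v i (u i).
  move=> uv; apply: functional_extensionality_dep => l.
  have [<-|il] := eqVneq i l; first by rewrite dfwithin.
  by rewrite dfwithout// uv// eq_sym.
move=> /fE xE /fE yE zE; rewrite (fE z z)// zE [in LHS]xE [in LHS]yE.
by rewrite -scaleN1r addrC -tens_multilinear scaleN1r addrC.
Qed.

(** The operator 1 (x) .. (x) A (x) .. (x) 1. For a sum u of elementary tensors
    with coefficients a k, c^2 |u|^2 - |T u|^2 is the value at a of the kernel
    (c^2 <x k i, x l i> - <A (x k i), A (x l i)>) * \prod_(j != i) <x k j, x l j>,
    a product of a positive kernel with Gram kernels. *)
Lemma tens_bounded_factor i (A : H i -> H i) : bounded_op A ->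
  exists2 T : HH -> HH, bounded_op T &
    forall x, T (tens HH x) = tens HH (dfwith x i (A (x i))).
Proof.
move=> [Al [c /positive_bound[{}c c0 Ac]]].
pose upd x := dfwith x i (A (x i)).
pose G (u v : HH) := exists (I : finType) (a : I -> C) (x : I -> forall l, H l),
  u = \sum_k a k *: tens HH (x k) /\ v = \sum_k a k *: tens HH (upd (x k)).
have Gtens x : G (tens HH x) (tens HH (upd x)).
  by exists unit, (fun=> 1), (fun=> x); rewrite !big_const !card_unit /= !scale1r !addr0.
have Glin (a : C) (u v u' v' : HH) : G u v -> G u' v' -> G (a *: u + u') (a *: v + v').
  move=> [I [p [x [-> ->]]]] [J [q [y [-> ->]]]].
  exists (I + J)%type, (fun s => match s with inl k => a * p k | inr l => q l end),
    (fun s => match s with inl k => x k | inr l => y l end).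
  rewrite !big_sumType /= !scaler_sumr.
  by split; congr (_ + _); apply: eq_bigr => k _; rewrite scalerA.
have Gbound (u v : HH) : G u v -> `|v| <= c * `|u|.
  move=> [I [a [x [uE vE]]]].
  rewrite -(@ler_pXn2r _ 2) ?nnegrE ?mulr_ge0// ?(ltW c0)// exprMn -!hdotxx -subr_ge0.
  have := psd_mul_prod_gram (V := H) [seq j <- index_enum 'I_n | j != i] x
    (psd_bounded_gram (fun k => x k i) Al (ltW c0) Ac) a.
  rewrite uE vE !hdot_sum mulr_sumr -sumrB; congr (0 <= _).
  apply: eq_bigr => k _; rewrite mulr_sumr -sumrB; apply: eq_bigr => l _.
  rewrite !tens_dot !(bigD1 (P := xpredT) i)//= /upd !dfwithin big_filter.
  have -> : \prod_(j | j != i)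
      '[dfwith (x k) i (A (x k i)) j, dfwith (x l) i (A (x l i)) j] =
    \prod_(j | j != i) '[x k j, x l j].
    by apply: eq_bigr => j ji; rewrite !dfwithout// eq_sym.
  ring.
have [||||T bT TG] := @bounded_relation_ext _ HH G c; rewrite ?(ltW c0)//; last first.
  by exists T => // x; apply: TG.
move=> u e e0; pose E (u : HH) := exists v, G u v.
have [|||w [v wv] uw] := closed_span_approx (E := E) (tens_dense HH) _ _ _ u e0.
- by exists 0, 'I_0, (fun=> 0), (fun _ _ => 0); rewrite !big_ord0.
- by move=> a y z [v yv] [w zw]; exists (a *: v + w); exact: Glin.
- by move=> _ [x _ <-]; exists (tens HH (upd x)).
- by exists w, v.
Qed.

Lemma tensor_op_eq (A : forall l, H l -> H l) (T : HH -> HH) : bounded_op T ->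
  (forall x, T (tens HH x) = tens HH (fun l => A l (x l))) -> tensor_op HH A = T.
Proof.
move=> bT TA; apply: xget_unique => // U [bU UA].
apply: (eq_bounded_op_total (tens_dense HH)) => // _ /set_mem[x _ <-].
by rewrite UA TA.
Qed.

(** By [tens_dot], subtracting the tensor product of the projections leaves a
    vector orthogonal to every elementary tensor with factors in the Q l. *)
Lemma orthoproj_tens (Q : forall l, set (H l)) x :
  (forall l, closed_subspace (Q l)) ->
  orthoproj (tensor_subspace HH Q) (tens HH x) = tens HH (fun l => orthoproj (Q l) (x l)).
Proof.
move=> cQ; apply: orthoproj_eq.
- exact: closed_subspace_closed_span.
- apply: sub_closed_span; exists (fun l => orthoproj (Q l) (x l)) => // l.
  exact: orthoproj_in.
- rewrite orthocompl_closed_span => _ [y yQ <-].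
  rewrite linearBl /= !tens_dot; apply/eqP; rewrite subr_eq0; apply/eqP.
  by apply: eq_bigr => l _; rewrite orthoproj_sym// orthoproj_id.
Qed.

End TensorOperators.

(** * Multiplication by the coordinates *)

Section CoordinateMultiplication.
Context {R : realType} {n : nat} {H : 'I_n -> rk_module R} (HH : hilbert_tensor H).
Implicit Types (x : forall l, H l) (i : 'I_n).

(** A tensor product of operators is defined by choice, with value 0 if there is
    no bounded candidate; [tens_bounded_factor] provides the candidate. *)
Lemma MziP i : bounded_op (Mzi HH i) /\
  forall x, Mzi HH i (tens HH x) = tens HH (fun l => if l == i then Mz (x l) else x l).
Proof.
have [T bT TM] := tens_bounded_factor HH (@Mz_bounded R (H i)).
have TE x : T (tens HH x) = tens HH (fun l => if l == i then Mz (x l) else x l).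
  rewrite TM; congr tens; apply: functional_extensionality_dep => l.
  have [->|li] := eqVneq l i; first by rewrite dfwithin.
  by rewrite dfwithout// eq_sym.
suff -> : Mzi HH i = T by [].
apply: tensor_op_eq => // x; rewrite TE; congr tens.
apply: functional_extensionality_dep => l.
have [->|li] := eqVneq l i; first by rewrite dfwithin.
by rewrite dfwithout// eq_sym.
Qed.

Lemma adjoint_Mzi_tens i x : adjoint (Mzi HH i) (tens HH x) =
  tens HH (fun l => if l == i then adjoint (@Mz R (H l)) (x l) else x l).
Proof.
have [bM ME] := MziP i; apply: (eq_hdot_total (tens_dense HH)) => _ [y _ <-].
rewrite adjointPl// ME !tens_dot; apply: eq_bigr => l _; case: ifP => // _.
by rewrite adjointPl//; exact: Mz_bounded.
Qed.
End CoordinateMultiplication.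

(** * Commutators of restrictions to an invariant subspace *)

Section RestrictedCommutator.
Context {R : realType}.

Lemma adjoint_on_restrict (V : hilbertType R) (S : set V) (T : V -> V) :
  closed_subspace S -> bounded_op T ->
  adjoint_on S (restrict_op S T) = orthoproj S \o adjoint T.
Proof.
move=> cS bT; apply/funext => x; apply: adjoint_onE => //; first exact: orthoproj_in.
move=> u Su; rewrite /restrict_op /= orthoproj_id// adjointP//.
by rewrite -orthoproj_sym// orthoproj_id.
Qed.

(** With P and P' the projections onto L and S, invariance of S gives
    P' T^* = P' T^* P' and U P' = P' U P', so that the commutator is
    P' T^* U P' - P' U P' T^* P' = P' U (1 - P') T^* P'. *)
Lemma commutator_restrict (V : hilbertType R) (L : set V) (T U : V -> V) :
  let S := orthocompl L in
  closed_subspace L -> bounded_op T -> bounded_op U ->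
  (forall x, S x -> S (T x)) -> (forall x, S x -> S (U x)) ->
  (forall x, adjoint T (U x) = U (adjoint T x)) ->
  commutator (adjoint_on S (restrict_op S T)) (restrict_op S U) =
  orthoproj S \o U \o orthoproj L \o adjoint T \o orthoproj S.
Proof.
move=> S cL bT bU ST SU TU.
have cS : closed_subspace S by exact: closed_subspace_orthocompl.
have bA := adjoint_bounded bT; have bP := orthoproj_bounded cS.
(* T^* maps L into the orthogonal complement of S. *)
have PA x : orthoproj S (adjoint T x) = orthoproj S (adjoint T (orthoproj S x)).
  apply/eqP; rewrite -subr_eq0 -(bounded_op_linearB _ _ bP) -(bounded_op_linearB _ _ bA).
  rewrite (orthoproj_compl cL x) opprB addrC subrK; apply/eqP/orthoproj0 => // y Sy.
  by rewrite adjointPl//; apply/hdot_eq0C/ST => //; exact: orthoproj_in.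
rewrite adjoint_on_restrict//; apply/funext => x; rewrite /commutator /restrict_op /=.
rewrite orthoproj_idem// (PA x); set y := orthoproj S x.
have Sy : S y := orthoproj_in cS x.
rewrite -[U (orthoproj S (adjoint T y))](orthoproj_id cS); last first.
  exact: SU _ (orthoproj_in cS _).
rewrite -(bounded_op_linearB _ _ bP) TU -(bounded_op_linearB _ _ bU).
by rewrite (orthoproj_compl cL (adjoint T y)) opprB addrC subrK.
Qed.
End RestrictedCommutator.

Theorem theorem5p3 (R : realType) (n : nat) (hn : (2 <= n)%N)
    (H : 'I_n -> rk_module R) (HH : hilbert_tensor H)
    (hH : analytic_hilbert_module H)
    (Q : forall i, set (H i)) (hQ : forall i, is_quotient_module (Q i))
    (S : set HH) (hS : co_doubly_commuting S)
    (hSQ : S = orthocompl (tensor_subspace HH Q))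
    (i j : 'I_n) (hij : (i < j)%N) :
  commutator (adjoint_on S (Rzi S i)) (Rzi S j) =
  tensor_op HH (fun l : 'I_n =>
    if l == i then orthoproj (Q l) \o adjoint (@Mz R (H l)) \o orthoproj (orthocompl (Q l))
    else if l == j then orthoproj (orthocompl (Q l)) \o @Mz R (H l) \o orthoproj (Q l)
    else orthoproj (Q l)).
Proof.
have ij : i != j by rewrite neq_ltn hij.
have cQ l : closed_subspace (Q l) by case: (hQ l).
set L := tensor_subspace HH Q in hSQ.
have cL : closed_subspace L by exact: closed_subspace_closed_span.
have cS : closed_subspace (orthocompl L) by exact: closed_subspace_orthocompl.
have [[_ SM] _] := hS; rewrite {}hSQ in SM *.
have [bi Ei] := MziP HH i; have [bj Ej] := MziP HH j.
have bA := adjoint_bounded bi; have bP := orthoproj_bounded cL.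
have bA1 l := adjoint_bounded (@Mz_bounded R (H l)).
have bP1 l := orthoproj_bounded (cQ l).
have comm x : adjoint (Mzi HH i) (Mzi HH j x) = Mzi HH j (adjoint (Mzi HH i) x).
  suff /(congr1 (fun f => f x)) : adjoint (Mzi HH i) \o Mzi HH j =
    Mzi HH j \o adjoint (Mzi HH i) by [].
  apply: (eq_bounded_op_total (tens_dense HH)); [exact: bounded_op_comp..|].
  move=> _ /set_mem[y _ <-] /=; rewrite Ej !adjoint_Mzi_tens Ej.
  congr tens; apply: functional_extensionality_dep => l.
  by case: (eqVneq l i) => [->|//]; rewrite (negbTE ij).
rewrite /Rzi commutator_restrict//; try exact: SM.
apply/esym/tensor_op_eq.
  do 4! (apply: bounded_op_comp; last by [| exact: orthoproj_bounded]).
  exact: orthoproj_bounded.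
move=> x /=.
rewrite (orthoproj_compl cL (tens HH x)) (bounded_op_linearB _ _ bA).
rewrite (bounded_op_linearB _ _ bP) (bounded_op_linearB _ _ bj).
rewrite !orthoproj_tens// !adjoint_Mzi_tens !orthoproj_tens// !Ej.
pose P l := orthoproj (Q l).
(* The factors of M_j P M_i^* P' (tens HH x): the terms for x and for its
   projection differ in position i only. *)
pose z l := if l == i then P l (adjoint (@Mz R (H l)) (x l - P l (x l)))
  else if l == j then Mz (P l (x l)) else P l (x l).
rewrite (@tensB_factor _ _ _ HH i _ _ z); last 3 first.
- by move=> l li; rewrite /z (negbTE li).
- by move=> l li; rewrite /z (negbTE li) orthoproj_idem.
- rewrite /z eqxx (negbTE ij).
  by rewrite -(bounded_op_linearB _ _ (bP1 i)) -(bounded_op_linearB _ _ (bA1 i)).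
rewrite orthoproj_compl// orthoproj_tens//.
apply: (@tensB_factor _ _ _ HH j).
- move=> l lj; rewrite /z (negbTE lj); case: eqVneq => //= _.
  by rewrite orthoproj_compl.
- move=> l lj; rewrite /z (negbTE lj); case: eqVneq => //= _.
    by rewrite orthoproj_compl// orthoproj_idem.
  by rewrite orthoproj_idem.
- by rewrite /z eq_sym (negbTE ij) eqxx /= orthoproj_compl.
Qed.
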